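(* Let $\epsilon=(\alpha,\beta,\gamma)$ be an embedding of a graph $G$ of genus $g(\epsilon)$, and let $\nu$ be a vertex of $G$ incident to $q$ faces of $\epsilon$. Let $\lambda(D_\nu)$ be the cycle type of the diagonal $D_\nu$ of the localization of $\epsilon$ at $\nu$. For an integer $\Delta g$, let $R_\nu(\Delta g)$ be the number of reembeddings $\beta'$ of $\nu$ such that the embedding $\epsilon'=(\alpha,\beta',\alpha\beta')$ satisfies $g(\epsilon')=g(\epsilon)+\Delta g$. Then $$R_\nu(\Delta g)=p^{\lambda(D_\nu)}_{q+2\Delta g}(deg(\nu)).$$
   Context: Composition: $(\sigma\tau)(x)=\sigma(\tau(x))$. A map with $m$ edges is a triple $(\alpha,\beta,\gamma)$ of permutations of $[2m]$ (half-edges), $\alpha$ a fixed-point-free involution (edges), cycles of $\beta$ the cyclic orders of half-edges at vertices, $\gamma=\alpha\beta$ whose cycles are the faces; its genus $g$ satisfies $C(\beta)-C(\alpha)+C(\gamma)=2-2g$, $C(\cdot)$ the number of cycles. The graph is $G=(\alpha,Par_\beta)$, vertices are blocks of $Par_\beta$ (partition into cycles of $\beta$), $deg(\nu)=|\nu|$; a face is incident to $\nu$ if it contains an element of $\nu$. A reembedding of $\nu$ is a permutation $\beta'$ with $\beta'(x)=\beta(x)$ for $x\notin\nu$ and $\beta'|_\nu$ a single cycle on $\nu$ (this includes $\beta$ itself). Localization at $\nu$: $s_\nu$ is the permutation of $\nu$ with $s_\nu(v)=\gamma^j(v)$ for the least $j\geq1$ with $\gamma^j(v)\in\nu$ (so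 $s_\nu$ has $q$ cycles), $\pi_\nu=\beta|_\nu$, and $D_\nu=s_\nu\circ\pi_\nu^{-1}$. For a partition $\lambda\vdash n$ and integer $k$, $p^\lambda_k(n)$ is the number of pairs $(s,\pi)$ of permutations of $[n]$ with $s$ an $n$-cycle, $\pi$ having exactly $k$ cycles, and $s\circ\pi^{-1}=D$, where $D$ is a fixed permutation of cycle type $\lambda$ (this number depends only on $\lambda$; it is $0$ if $k\leq 0$).
   Formalization: The index q+2Δg is corrected to q−2Δg: by C(β)−C(α)+C(γ)=2−2g, raising the genus by Δg removes 2Δg faces; the printed sign fails for α=(01)(23), β=(0 2 1 3), where q=1 and R(−1)≥1 but p_{−1}=0. *)

(* Defs.v *)
From HB Require Import structures.
From mathcomp Require Import all_boot all_order all_fingroup all_algebra.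
From mathcomp Require Import ring.

Set Implicit Arguments.
Unset Strict Implicit.
Unset Printing Implicit Defensive.

Import Order.TTheory GRing.Theory Num.Theory.

(* MathComp's product of permutations applies its left factor first, whereas
   perm_comp s t is the usual composite x |-> s (t x). *)
Definition perm_comp (T : finType) (s t : {perm T}) : {perm T} := (t * s)%g.

Lemma perm_compE (T : finType) (s t : {perm T}) x : perm_comp s t x = s (t x).
Proof. by rewrite /perm_comp permM. Qed.

(* Fixed points count as cycles: they are singleton blocks of porbits. *)
Definition ncycles (T : finType) (s : {perm T}) : nat := #|porbits s|.

(* s preserves A and its restriction to A is a single cycle on all of A. *)
Definition single_cycle_on (T : finType) (A : {set T}) (s : {perm T}) : bool :=
  A \in porbits s.

(* The partition of #|T| formed by the cycle lengths, in decreasing order. *)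
Definition cycle_type (T : finType) (s : {perm T}) : seq nat :=
  sort geq [seq #|C| | C : {set T} <- enum (porbits s)].

Record cmap (m : nat) := CMap {
  alpha : {perm 'I_(2 * m)};
  beta  : {perm 'I_(2 * m)};
  gamma : {perm 'I_(2 * m)};
  alpha_inv : forall x, alpha (alpha x) = x;
  alpha_nofix : forall x, alpha x != x;
  gammaE : gamma = perm_comp alpha beta
}.

Record graph (m : nat) := Graph {
  edge_inv : {perm 'I_(2 * m)};
  vertices : {set {set 'I_(2 * m)}}
}.

Definition graph_of m (e : cmap m) : graph m :=
  Graph (alpha e) (porbits (beta e)).

Definition faces m (e : cmap m) : {set {set 'I_(2 * m)}} := porbits (gamma e).

Definition deg m (nu : {set 'I_(2 * m)}) : nat := #|nu|.

Definition incident_faces m (e : cmap m) (nu : {set 'I_(2 * m)}) :=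
  [set f in faces e | f :&: nu != set0].

Section Genus.
Local Open Scope ring_scope.

(* Connectedness is not required, so the genus may be negative.  The division
   is exact, see genusP. *)
Definition genus m (e : cmap m) : int :=
  ((2 - ((ncycles (beta e))%:Z - (ncycles (alpha e))%:Z
         + (ncycles (gamma e))%:Z)) %/ 2)%Z.

Lemma genusP m (e : cmap m) :
  (ncycles (beta e))%:Z - (ncycles (alpha e))%:Z + (ncycles (gamma e))%:Z
  = 2 - 2 * genus e.
Proof.
have odd_ncycles (s : {perm 'I_(2 * m)}) : odd (ncycles s) = odd_perm s.
  by rewrite /odd_perm /ncycles [in RHS](_ : odd _ = false) // card_ord mul2n odd_double.
have ev : ~~ odd (ncycles (alpha e) + ncycles (beta e) + ncycles (gamma e)).
  rewrite !oddD !odd_ncycles gammaE /perm_comp odd_permM.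
  by case: (odd_perm _); case: (odd_perm _).
have hd : (2 %| 2 - ((ncycles (beta e))%:Z - (ncycles (alpha e))%:Z
                     + (ncycles (gamma e))%:Z))%Z.
  have -> : 2 - ((ncycles (beta e))%:Z - (ncycles (alpha e))%:Z
                 + (ncycles (gamma e))%:Z)
    = 2 * (1 + (ncycles (alpha e))%:Z)
      - (ncycles (alpha e) + ncycles (beta e) + ncycles (gamma e))%N%:Z :> int.
    by rewrite !PoszD; ring.
  apply: rpredB; first by rewrite dvdz_mulr.
  by rewrite dvdzE /= dvdn2.
by rewrite [2 * _]mulrC /genus divzK // subKr.
Qed.

End Genus.

(* The map with the same edges and vertex permutation b. *)
Definition reembed m (e : cmap m) (b : {perm 'I_(2 * m)}) : cmap m :=
  CMap (alpha_inv e) (alpha_nofix e) (erefl (perm_comp (alpha e) b)).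

Definition is_reembedding m (e : cmap m) (nu : {set 'I_(2 * m)})
    (b : {perm 'I_(2 * m)}) : bool :=
  [forall x, (x \notin nu) ==> (b x == beta e x)] && single_cycle_on nu b.

Definition R_count m (e : cmap m) (nu : {set 'I_(2 * m)}) (dg : int) : nat :=
  #|[set b : {perm 'I_(2 * m)} |
      is_reembedding e nu b && (genus (reembed e b) == genus e + dg)%R]|.

Section FirstReturn.
Variables (T : finType) (A : {set T}) (s : {perm T}).

Fact return_ex (v : {x | x \in A}) :
  exists j, (0 < j) && (iter j s (val v) \in A).
Proof.
by exists #[s]%g; rewrite order_gt0 -permX expg_order perm1 (valP v).
Qed.

Definition return_time v : nat := ex_minn (return_ex v).

Fact return_in v : iter (return_time v) s (val v) \in A.
Proof. by rewrite /return_time; case: ex_minnP => j /andP[]. Qed.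

Definition first_return v : {x | x \in A} := 
  exist (fun x => x \in A) _ (return_in v).

Fact first_return_inj : injective first_return.
Proof.
have key v w : return_time v <= return_time w ->
    iter (return_time v) s (val v) = iter (return_time w) s (val w) -> v = w.
  rewrite /return_time; case: ex_minnP => i /andP[i0 _] _.
  case: ex_minnP => j /andP[j0 _] minj le_ij.
  rewrite -{1}(subnKC le_ij) iterD -!permX => /perm_inj.
  rewrite permX => Evw.
  have [ij0 | ij0] := posnP (j - i).
    by apply: val_inj; rewrite Evw ij0.
  have := minj (j - i); rewrite ij0 -Evw (valP v) => /(_ isT).
  by rewrite leqNgt ltn_subrL i0 j0.
move=> v w /(congr1 val) /= Evw.
have [le|/ltnW le] := leqP (return_time v) (return_time w); first exact: key.
by apply/esym/key => //; apply/esym.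
Qed.

Definition induced_perm : {perm {x | x \in A}} := perm first_return_inj.

End FirstReturn.

Section Restriction.
Variables (T : finType) (A : {set T}) (s : {perm T}).
Hypothesis sA : single_cycle_on A s.

Fact restr_in (v : {x | x \in A}) : s (val v) \in A.
Proof.
case: v => y /= yA; case/imsetP: sA yA => x _ -> /porbitP[i ->].
by rewrite -permM -expgSr mem_porbit.
Qed.

Definition restr_fun v : {x | x \in A} := 
  exist (fun x => x \in A) _ (restr_in v).

Fact restr_fun_inj : injective restr_fun.
Proof. by move=> v w /(congr1 val) /= /perm_inj /val_inj. Qed.

Definition restr_to : {perm {x | x \in A}} := perm restr_fun_inj.

End Restriction.

Definition loc_s m (e : cmap m) (nu : {set 'I_(2 * m)}) :
  {perm {x | x \in nu}} := induced_perm nu (gamma e).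

Definition loc_pi m (e : cmap m) (nu : {set 'I_(2 * m)})
    (nuV : nu \in vertices (graph_of e)) : {perm {x | x \in nu}} :=
  restr_to nuV.

Definition diagonal m (e : cmap m) (nu : {set 'I_(2 * m)})
    (nuV : nu \in vertices (graph_of e)) : {perm {x | x \in nu}} :=
  perm_comp (loc_s e nu) (loc_pi nuV)^-1%g.

Definition pair_count (n : nat) (D : {perm 'I_n}) (k : int) : nat :=
  #|[set sp : {perm 'I_n} * {perm 'I_n} |
      [&& single_cycle_on [set: 'I_n] sp.1,
          ((ncycles sp.2)%:Z == k)%R &
          perm_comp sp.1 (sp.2)^-1%g == D]]|.

(* D is an arbitrarily chosen permutation of cycle type lam; permutations of
   the same cycle type give the same count.  The default 0 is returned only
   when lam is not a decreasing list of positive integers with sum n. *)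
Definition p_count (lam : seq nat) (k : int) (n : nat) : nat :=
  if [pick D : {perm 'I_n} | cycle_type D == lam] is Some D
  then pair_count D k else 0.

(* Main.v *)
(* A reembedding b' of nu is determined by the full cycle p it induces on nu.
   Since alpha b' agrees with gamma = alpha beta outside nu, the faces avoiding
   nu are unchanged, while the first-return permutation of alpha b' on nu is
   s_nu pi_nu^-1 p = D p, whose cycles are the faces meeting nu.  Hence the genus
   rises by dg iff D p has q - 2 dg cycles.  Finally, the pairs (s, p') with
   s p'^-1 = D0 are those with p' = D0^-1 s, and D0^-1 is conjugate to D, having
   the same cycle type. *)
Require Import Defs.
From HB Require Import structures.
From mathcomp Require Import all_boot all_order all_fingroup all_algebra.
From mathcomp Require Import zify.

Set Implicit Arguments.
Unset Strict Implicit.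
Unset Printing Implicit Defensive.

(** * Cycle invariants under equivariant maps *)

Section Morphism.
Variables (T S : finType) (f : T -> S) (s : {perm T}) (t : {perm S}).
Hypothesis fs : forall x, f (s x) = t (f x).

Lemma morph_permX k x : f ((s ^+ k)%g x) = (t ^+ k)%g (f x).
Proof. by rewrite !permX; elim: k => //= k <-. Qed.

Lemma porbit_morph x : porbit t (f x) = f @: porbit s x.
Proof.
apply/setP=> y; apply/porbitP/imsetP => [[k ->] | [z /porbitP[k ->] ->]].
  by exists ((s ^+ k)%g x); rewrite ?mem_porbit // morph_permX.
by exists k; rewrite morph_permX.
Qed.

Hypothesis f_bij : bijective f.

Lemma porbits_morph : porbits t = [set f @: C | C : {set T} in porbits s].
Proof.
have [g fK gK] := f_bij; apply/setP=> C; apply/imsetP/imsetP.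
  case=> y _ ->; exists (porbit s (g y)); first exact: imset_f.
  by rewrite -porbit_morph gK.
by case=> _ /imsetP[x _ ->] ->; exists (f x); rewrite ?porbit_morph.
Qed.

Lemma ncycles_morph : ncycles t = ncycles s.
Proof.
by rewrite /ncycles porbits_morph card_imset //; apply/imset_inj/bij_inj.
Qed.

Lemma single_cycle_on_morph :
  single_cycle_on [set: S] t = single_cycle_on [set: T] s.
Proof.
have f_inj := bij_inj f_bij.
have <- : f @: [set: T] = [set: S].
  apply/eqP; rewrite eqEcard subsetT card_imset // !cardsT.
  by rewrite (bij_eq_card f_bij) /=.
by rewrite /single_cycle_on porbits_morph mem_imset //; apply: imset_inj.
Qed.

Lemma cycle_type_morph : cycle_type t = cycle_type s.
Proof.
have f_inj := bij_inj f_bij.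
apply/perm_sortP; [by move=> x y; rewrite /geq /= leq_total
  | by move=> x y z /= xy yz; apply: leq_trans yz xy
  | by move=> x y; rewrite /geq /= -eqn_leq => /eqP | ].
have -> : [seq #|C| | C : {set T} <- enum (porbits s)]
        = [seq #|C| | C : {set S} <-
             [seq f @: C | C : {set T} <- enum (porbits s)]].
  by rewrite -map_comp; apply: eq_map => C /=; rewrite card_imset.
apply/perm_map/uniq_perm; first exact: enum_uniq.
  by rewrite map_inj_uniq ?enum_uniq //; apply: imset_inj.
move=> C; rewrite mem_enum porbits_morph; apply/imsetP/mapP => -[D DP ->];
  by exists D => //; rewrite ?mem_enum // -mem_enum.
Qed.

End Morphism.

(** * Conjugacy of permutations of equal cycle type *)

Lemma eq_permX_porbit (T : finType) (s : {perm T}) x i j :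
  ((s ^+ i)%g x == (s ^+ j)%g x) = (i == j %[mod #|porbit s x|]).
Proof.
set n := #|_|; have n_gt0 : 0 < n by rewrite lt0n card_porbit_neq0.
have redn k : (s ^+ k)%g x = iter (k %% n) s x.
  rewrite permX {1}(divn_eq k n) addnC iterD; congr iter.
  by elim: (k %/ n) => //= l IH; rewrite mulSn iterD IH iter_porbit.
have red k : (s ^+ k)%g x = nth x (traject s x n) (k %% n).
  by rewrite nth_traject ?ltn_pmod.
(* The first [n] iterates of [x] are distinct, so equality of points becomes equality of
   positions. *)
by rewrite !red nth_uniq ?size_traject ?ltn_pmod ?uniq_traject_porbit.
Qed.

(** The map sends [s^k a] to [t^k b], where [k] is the position of the point in the trajectory of
    [a]. Wrapping around at the end of the trajectory is harmless because both cycles have the same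
    length. *)
Lemma porbit_equivariant (T S : finType) (s : {perm T}) (t : {perm S}) a b :
    #|porbit s a| = #|porbit t b| ->
  exists g : T -> S, [/\ {in porbit s a, forall x, g (s x) = t (g x)},
    {in porbit s a, forall x, g x \in porbit t b} &
    {in porbit s a &, injective g}].
Proof.
move=> eqc; pose k x := index x (traject s a #|porbit s a|).
have kP x : x \in porbit s a -> (s ^+ k x)%g a = x.
  rewrite porbit_traject => xa; rewrite permX -(@nth_traject _ s _ #|porbit s a|).
    by rewrite nth_index.
  by rewrite -[X in _ < X](size_traject s a) index_mem.
exists (fun x => (t ^+ k x)%g b); split=> [x xa | x xa | x y xa ya].
- have sxa : s x \in porbit s a by rewrite -(kP _ xa) -permM -expgSr mem_porbit.
  rewrite -permM -expgSr; apply/eqP; rewrite eq_permX_porbit -eqc -eq_permX_porbit.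
  by rewrite kP // expgSr permM kP.
- exact: mem_porbit.
- move=> /eqP; rewrite eq_permX_porbit -eqc -eq_permX_porbit => /eqP.
  by rewrite !kP.
Qed.

(** Serves to match the cycles of two permutations length by length. A permutation [Is] of positions
    turns [map g e2] into [map f e1]; the entry of [e1] at position [i] goes to the entry of [e2] at
    position [nth 0 Is i]. *)
Lemma perm_map_inj (T S R : eqType) (f : T -> R) (g : S -> R) e1 e2 :
    uniq e2 -> perm_eq (map f e1) (map g e2) ->
  exists2 h : {x | x \in e1} -> S, injective h &
    forall x, h x \in e2 /\ g (h x) = f (val x).
Proof.
(* If [e2] is empty then so is [e1], and [h] has an empty domain; otherwise the head [y0] is the
   default for [nth]. *)
case: e2 => [|y0 e2'].
  move=> _ /perm_size/eqP; rewrite size_map size_eq0 => /eqP->.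
  by exists (fun x => False_rect S (notF (valP x))) => x; case: (notF (valP x)).
set e2 := _ :: _ => e2u /(perm_iotaP (g y0))[Is IsP fE].
have sI : size Is = size e1 by rewrite -(size_map f) fE size_map.
have szI : size Is = size e2 by rewrite (perm_size IsP) size_iota size_map.
have ixI (x : {x | x \in e1}) : index (val x) e1 < size Is.
  by rewrite sI index_mem (valP x).
pose J x := nth 0 Is (index x e1).
have Jlt (x : {x | x \in e1}) : J (val x) < size e2.
  have : J (val x) \in Is by apply: mem_nth.
  by rewrite (perm_mem IsP) mem_iota size_map.
exists (fun x => nth y0 e2 (J (val x))) => [x y /eqP | x].
  rewrite nth_uniq // nth_uniq // => [/eqP Exy|].
    by apply: val_inj; rewrite -(nth_index (val x) (valP x)) Exy nth_index ?(valP y).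
  by rewrite (perm_uniq IsP) iota_uniq.
split; first exact: mem_nth.
rewrite -(nth_map _ (g y0)) //.
rewrite -(nth_map 0 (g y0) (fun i => nth (g y0) (map g e2) i)) // -fE.
by rewrite (nth_map (val x)) -?sI // nth_index ?(valP x).
Qed.

(** Cycles of equal length are paired by an injection [h], each pair is joined by an equivariant
    injection, and these glue to [f]. Equal cardinalities then turn injectivity into bijectivity. *)
Lemma cycle_type_conj (T S : finType) (s : {perm T}) (t : {perm S}) :
    #|T| = #|S| -> cycle_type s = cycle_type t ->
  exists2 f : T -> S, bijective f & forall x, f (s x) = t (f x).
Proof.
move=> cTS ct.
have : perm_eq [seq #|C| | C : {set T} <- enum (porbits s)]
               [seq #|C| | C : {set S} <- enum (porbits t)].
  have := perm_refl (cycle_type s).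
  by rewrite {2}ct perm_sort perm_sym perm_sort perm_sym.
case/perm_map_inj=> [|h h_inj hP]; first exact: enum_uniq.
have orbP x : porbit s x \in enum (porbits s) by rewrite mem_enum imset_f.
pose orb x : {C | C \in enum (porbits s)} := exist _ (porbit s x) (orbP x).
have /fin_all_exists [G GP] (C : {C | C \in enum (porbits s)}) :
  exists g : T -> S, [/\ {in val C, forall x, g (s x) = t (g x)},
    {in val C, forall x, g x \in h C} & {in val C &, injective g}].
  case: C (hP C) => C CP /= []; have := CP; rewrite !mem_enum.
  by case/imsetP=> a _ Ca /imsetP[b _ ->]; rewrite {}Ca => /esym/porbit_equivariant.
pose f x := G (orb x) x.
have fh x : f x \in h (orb x) by have [_ -> //] := GP (orb x); apply: porbit_id.
(* Cycles of [t] are disjoint, so the value [f x] determines its cycle, and injectivity of [h]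
   recovers the cycle of [x]. *)
have orb_h x y : f x \in h (orb y) -> orb x = orb y.
  move=> fxy; apply: h_inj; have := fh x; have := fxy.
  have [] := hP (orb x); have [] := hP (orb y).
  rewrite !mem_enum => /imsetP[b _ ->] _ /imsetP[c _ ->] _.
  by rewrite -!eq_porbit_mem => /eqP <- /eqP.
exists f => [|x].
  apply: inj_card_bij => [x y fxy|]; last by rewrite cTS.
  have oxy : orb x = orb y by apply: orb_h; rewrite fxy.
  have [_ _] := GP (orb y); apply; rewrite ?porbit_id //.
    by rewrite -oxy porbit_id.
  by rewrite -[in LHS]oxy.
have -> : f (s x) = G (orb x) (s x).
  by congr (G _ _); apply/val_inj; rewrite /= -[s x]/((s ^+ 1)%g x) porbit_perm.
by have [-> //] := GP (orb x); apply: porbit_id.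
Qed.

Section Transport.
Variables (T S : finType) (f : T -> S) (g : S -> T).
Hypotheses (fK : cancel f g) (gK : cancel g f).

Fact transport_inj (s : {perm T}) : injective (fun y => f (s (g y))).
Proof. by move=> x y /(can_inj fK)/perm_inj/(can_inj gK). Qed.

Definition transport_perm (s : {perm T}) : {perm S} := perm (transport_inj (s := s)).

Lemma transport_permE (s : {perm T}) x : f (s x) = transport_perm s (f x).
Proof. by rewrite permE fK. Qed.

End Transport.

(** * Cycles of the first-return permutation *)

Section FirstReturnCycles.
Variables (T : finType) (A : {set T}) (s : {perm T}).
Implicit Types v w : {x | x \in A}.

Lemma return_time_gt0 v : 0 < return_time s v.
Proof. by rewrite /return_time; case: ex_minnP => j /andP[]. Qed.

Lemma return_time_min v j :
  0 < j -> iter j s (val v) \in A -> return_time s v <= j.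
Proof.
by rewrite /return_time; case: ex_minnP => i _ imin j0 jA; apply/imin/andP.
Qed.

Lemma val_induced_perm v :
  val (induced_perm A s v) = iter (return_time s v) s (val v).
Proof. by rewrite permE. Qed.

Lemma mem_porbit_induced_perm v w :
  (w \in porbit (induced_perm A s) v) = (val w \in porbit s (val v)).
Proof.
apply/idP/idP => [/porbitP[k ->] | /porbitP[k]].
  elim: k => [|k IH]; first by rewrite expg0 perm1 porbit_id.
  rewrite expgSr permM val_induced_perm -permX.
  by rewrite -eq_porbit_mem porbit_perm eq_porbit_mem.
(* Strong induction on the number of [s]-steps from [v] to [w]: the first return uses up at least
   one of them and does not overshoot [w], which lies in [A]. *)
rewrite permX; have [n] := ubnP k; elim: n k v => // n IH [|k] v kn wE.
  by rewrite (val_inj wE) porbit_id.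
have le_rk : return_time s v <= k.+1.
  by apply: return_time_min; rewrite // -wE (valP w).
have <- : porbit (induced_perm A s) (induced_perm A s v)
        = porbit (induced_perm A s) v by apply: (porbit_perm _ 1).
apply: (IH (k.+1 - return_time s v)).
  by have := return_time_gt0 v; lia.
by rewrite val_induced_perm -iterD subnK.
Qed.

(** For [gamma e] and a vertex this is convertible to [incident_faces], which [R_countE]
    exploits. *)
Definition meeting_cycles : {set {set T}} :=
  [set C in porbits s | C :&: A != set0].

(** Intersecting with [A] maps the cycles of [s] that meet [A] onto the induced cycles; it is
    injective since two cycles sharing a point of [A] coincide. *)
Lemma ncycles_induced_perm : ncycles (induced_perm A s) = #|meeting_cycles|.
Proof.
have orb v : porbit (induced_perm A s) v = val @^-1: porbit s (val v).
  by apply/setP=> w; rewrite inE mem_porbit_induced_perm.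
rewrite /ncycles (_ : porbits _ =
    [set val @^-1: C | C : {set T} in meeting_cycles]).
  rewrite card_in_imset // => C C'; rewrite !inE => /andP[/imsetP[x _ ->]].
  case/set0Pn=> y /setIP[yx yA] /andP[/imsetP[x' _ ->] _].
  move/setP/(_ (exist _ y yA)); rewrite !inE /= yx => /esym yx'.
  by apply/eqP; move: yx yx'; rewrite -!eq_porbit_mem => /eqP-> /eqP->.
apply/setP=> C; apply/imsetP/imsetP => -[].
  move=> v _ ->; exists (porbit s (val v)) => //.
  rewrite inE imset_f //; apply/set0Pn; exists (val v).
  by rewrite inE porbit_id (valP v).
move=> B; rewrite inE => /andP[/imsetP[x _ ->] /set0Pn[y /setIP[yx yA]]] ->.
exists (exist _ y yA) => //; rewrite orb /=.
by move: yx; rewrite -eq_porbit_mem => /eqP->.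
Qed.

Lemma meeting_cycles_single : single_cycle_on A s -> meeting_cycles = [set A].
Proof.
move=> /imsetP[x _ Ax]; apply/setP=> C; rewrite !inE; apply/andP/eqP.
  case=> /imsetP[y _ ->] /set0Pn[z]; rewrite Ax inE -!eq_porbit_mem.
  by case/andP=> /eqP<- /eqP<-.
move=> ->; rewrite {1}Ax imset_f //; split=> //; apply/set0Pn; exists x.
by rewrite setIid Ax porbit_id.
Qed.

End FirstReturnCycles.

(** * Permutations that agree outside a set *)

Section AgreeOutside.
Variables (T : finType) (A : {set T}).
Implicit Types s t : {perm T}.

Lemma avoiding_cycles_sub s t : {in ~: A, s =1 t} ->
  [set C in porbits s | C :&: A == set0] \subset
  [set C in porbits t | C :&: A == set0].
Proof.
move=> st; apply/subsetP=> C; rewrite !inE => /andP[/imsetP[x _ ->] CA].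
rewrite CA andbT; apply/imsetP; exists x => //.
have eqX k : (s ^+ k)%g x = (t ^+ k)%g x.
  elim: k => [|k IH]; first by rewrite !expg0.
  rewrite !expgSr !permM -IH st // inE; apply: contraTN CA => xA.
  by apply/set0Pn; exists ((s ^+ k)%g x); rewrite inE mem_porbit.
by apply/setP=> y; apply/porbitP/porbitP=> -[k ->]; exists k.
Qed.

(** The cycles avoiding [A] are common to [s] and [t]. Sums are compared in order to avoid truncated
    subtraction. *)
Lemma ncycles_agree_outside s t : {in ~: A, s =1 t} ->
  ncycles s + #|meeting_cycles A t| = ncycles t + #|meeting_cycles A s|.
Proof.
move=> st; have split (u : {perm T}) : ncycles u = #|meeting_cycles A u| +
    #|[set C in porbits u | C :&: A == set0]|.
  rewrite /ncycles -(cardsID [set C : {set T} | C :&: A != set0]).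
  by congr (_ + _); apply: eq_card => C; rewrite !inE ?negbK // andbC.
have -> := split s; have -> := split t.
rewrite (_ : [set C in porbits s | C :&: A == set0] =
  [set C in porbits t | C :&: A == set0]); first by lia.
apply/eqP; rewrite eqEsubset !avoiding_cycles_sub //.
by move=> x xA; rewrite st.
Qed.

Lemma induced_perm_comp s t (r : {perm {x | x \in A}}) :
    {in ~: A, t =1 s} -> (forall v, t (val v) = s (val (r v))) ->
  induced_perm A t = perm_comp (induced_perm A s) r.
Proof.
move=> ts tr; apply/permP=> v; apply: val_inj.
rewrite perm_compE !val_induced_perm.
(* The two trajectories may differ at time 0; they merge at time 1 and stay together until [A] is
   reached. *)
have run j : 0 < j -> (forall i, 0 < i < j -> iter i s (val (r v)) \notin A) ->
    iter j t (val v) = iter j s (val (r v)).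
  case: j => // j _; elim: j => [|j IH] out; first by rewrite /= tr.
  rewrite iterS IH => [|i /andP[i0 ij]]; last by apply: out; rewrite i0 ltnW.
  by rewrite ts //; rewrite inE out /=.
have before i : 0 < i < return_time s (r v) -> iter i s (val (r v)) \notin A.
  case/andP=> i0; apply: contraTN => /(return_time_min i0).
  by rewrite leqNgt.
(* Along the merged trajectory the [s]-return is a [t]-return, and an earlier [t]-return would
   contradict the minimality of the [s]-return. *)
have Ert : return_time t v = return_time s (r v).
  apply/eqP; rewrite eqn_leq return_time_min ?return_time_gt0 //=; last first.
    by rewrite run ?return_time_gt0 // return_in.
  rewrite leqNgt; apply/negP=> lt_ts.
  have := before (return_time t v); rewrite lt_ts return_time_gt0 => /(_ isT).
  rewrite -run ?return_time_gt0 ?return_in // => i /andP[i0 it].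
  by apply: before; rewrite i0 (ltn_trans it).
by rewrite Ert run // return_time_gt0.
Qed.

End AgreeOutside.

(** * Replacing one cycle of a permutation *)

Section Extension.
Variables (T : finType) (A : {set T}) (b : {perm T}).
Hypothesis bA : single_cycle_on A b.
Implicit Type p : {perm {x | x \in A}}.

(** Stability of [A] and of its complement under [b] is what makes the gluing [ext_fun]
    injective. *)
Lemma single_cycle_mem x : (b x \in A) = (x \in A).
Proof.
case/imsetP: bA => y _ ->; rewrite -!eq_porbit_mem.
by rewrite -(porbit_perm b 1 x).
Qed.

Definition ext_fun p x := if insub x is Some v then val (p v) else b x.

Fact ext_fun_inj p : injective (ext_fun p).
Proof.
move=> x y; rewrite /ext_fun.
case: insubP => [v _ <-|xA]; case: insubP => [w _ <-|yA].
- by move/val_inj/perm_inj->.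
- by move=> E; move: yA; rewrite -single_cycle_mem -E (valP (p v)).
- by move=> E; move: xA; rewrite -single_cycle_mem E (valP (p w)).
- exact: perm_inj.
Qed.

Definition ext_perm p : {perm T} := perm (@ext_fun_inj p).

Lemma ext_perm_val p v : ext_perm p (val v) = val (p v).
Proof. by rewrite permE /ext_fun valK. Qed.

Lemma ext_perm_out p x : x \notin A -> ext_perm p x = b x.
Proof. by move=> xA; rewrite permE /ext_fun insubN. Qed.

Lemma ext_perm_inj : injective ext_perm.
Proof.
move=> p p' E; apply/permP=> v; apply: val_inj.
by rewrite -!ext_perm_val E.
Qed.

Lemma single_cycle_ext_perm p :
  single_cycle_on A (ext_perm p) = single_cycle_on [set: {x | x \in A}] p.
Proof.
have orb v : porbit (ext_perm p) (val v) = val @: porbit p v.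
  by apply: porbit_morph => w; rewrite ext_perm_val.
have imT : val @: [set: {x | x \in A}] = A.
  apply/setP=> x; apply/imsetP/idP => [[v _ ->] | xA]; first exact: valP.
  by exists (exist _ x xA).
apply/imsetP/imsetP=> -[].
  move=> x _ E; have xA : x \in A by rewrite E porbit_id.
  exists (exist _ x xA) => //; apply: (imset_inj val_inj).
  by rewrite -orb /= -E imT.
by move=> v _ E; exists (val v); rewrite // orb -E imT.
Qed.

(** Every reembedding arises as an [ext_perm]; with [ext_perm_inj] this parametrizes reembeddings by
    full cycles on the vertex. *)
Lemma ext_restr (c : {perm T}) (cA : single_cycle_on A c) :
  {in ~: A, c =1 b} -> ext_perm (restr_to cA) = c.
Proof.
move=> cb; apply/permP=> x; have [xA | xA] := boolP (x \in A).
  by rewrite (ext_perm_val _ (exist _ x xA)) permE.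
by rewrite ext_perm_out // cb // inE.
Qed.

End Extension.

(** * The two counts as numbers of full cycles *)

Lemma cycle_typeV (T : finType) (s : {perm T}) : cycle_type s^-1%g = cycle_type s.
Proof. by rewrite /cycle_type porbitsV. Qed.

Lemma pair_count_conj (T : finType) n (D : {perm T}) (D0 : {perm 'I_n}) k :
    #|T| = n -> cycle_type D = cycle_type D0 ->
  pair_count D0 k =
  #|[set p : {perm T} | single_cycle_on [set: T] p &&
      ((ncycles (perm_comp D p))%:Z == k)%R]|.
Proof.
move=> cT ctD.
(* Conjugating [D^-1], not [D], to [D0] makes [f] carry [D] to [D0^-1], hence [D p] to the second
   component of a pair. *)
have [||f [g fK gK] fD] := @cycle_type_conj _ _ D^-1%g D0.
- by rewrite card_ord.
- by rewrite cycle_typeV.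
have fDV x : f (D x) = D0^-1%g (f x).
  by apply: (@perm_inj _ D0); rewrite -fD permK permKV.
have f_bij : bijective f by exists g.
(* The second component is forced: [s p^-1 = D0] means [p = D0^-1 s]. *)
pose F p := (transport_perm fK gK p, perm_comp D0^-1%g (transport_perm fK gK p)).
have F_inj : injective F.
  move=> p p' [E _]; apply/permP=> x; apply: (can_inj fK).
  by rewrite !(transport_permE fK gK) E.
rewrite -(card_imset _ F_inj); apply: eq_card => -[s p]; rewrite inE /=.
have nF p' : ncycles (perm_comp D0^-1%g (transport_perm fK gK p')) =
             ncycles (perm_comp D p').
  apply: ncycles_morph f_bij => x.
  by rewrite !perm_compE fDV (transport_permE fK gK).
have sF p' : single_cycle_on [set: 'I_n] (transport_perm fK gK p') =
             single_cycle_on [set: T] p'.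
  by apply: single_cycle_on_morph f_bij => x; rewrite (transport_permE fK gK).
apply/and3P/imsetP => [[sc nc /eqP E] | [p']].
  have s_transport : s = transport_perm fK gK (transport_perm gK fK s).
    by apply/permP=> x; rewrite !permE !gK.
  have pE : p = perm_comp D0^-1%g s.
    by rewrite -E /perm_comp invMg invgK mulKVg.
  exists (transport_perm gK fK s); last by rewrite /F -s_transport -pE.
  by rewrite inE -sF -s_transport sc -nF -s_transport -pE.
rewrite inE => /andP[sc nc] [-> ->]; rewrite sF nF; split=> //.
by rewrite /perm_comp invMg invgK mulgKV.
Qed.

Lemma R_countE m (e : cmap m) (nu : {set 'I_(2 * m)})
    (nuV : nu \in vertices (graph_of e)) (dg : int) :
  R_count e nu dg =
  #|[set p : {perm {x | x \in nu}} | single_cycle_on [set: {x | x \in nu}] p &&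
      ((ncycles (perm_comp (diagonal nuV) p))%:Z ==
       #|incident_faces e nu|%:Z - 2 * dg)%R]|.
Proof.
have bV : single_cycle_on nu (beta e) := nuV.
rewrite -(card_imset _ (@ext_perm_inj _ _ _ bV)); apply: eq_card => b.
have key p : let c := ext_perm bV p in single_cycle_on nu c ->
    (genus (reembed e c) == genus e + dg)%R =
    ((ncycles (perm_comp (diagonal nuV) p))%:Z ==
       #|incident_faces e nu|%:Z - 2 * dg)%R.
  move=> c cV.
  have cb : {in ~: nu, c =1 beta e} by move=> x; rewrite inE => xA; apply: ext_perm_out.
  have gc : {in ~: nu, gamma (reembed e c) =1 gamma e}.
    by move=> x xA; rewrite /= gammaE !perm_compE cb.
  have Eb := ncycles_agree_outside cb.
  (* [nu] is a single cycle of both vertex permutations, so their cycle counts agree. *)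
  rewrite !meeting_cycles_single // !cards1 in Eb.
  have Eg := ncycles_agree_outside gc.
  rewrite -[in X in X = _]/(incident_faces e nu) in Eg.
  rewrite -(ncycles_induced_perm _ (gamma (reembed e c))) in Eg.
  have Ei : induced_perm nu (gamma (reembed e c)) = perm_comp (diagonal nuV) p.
    (* At a half-edge [v] of [nu], the new face permutation gives [alpha (p v)], which is [gamma]
       applied to [pi^-1 (p v)]; this dictates the choice of [r]. *)
    rewrite (induced_perm_comp (s := gamma e) (r := (p * (loc_pi nuV)^-1)%g)) //.
      by rewrite /diagonal /perm_comp mulgA.
    move=> v; rewrite /= gammaE !perm_compE ext_perm_val; congr (alpha e _).
    by rewrite -[in LHS](permKV (loc_pi nuV) (p v)) permE.
  rewrite {}Ei in Eg.
  (* Vertex and edge counts are unchanged, so subtracting the two Euler formulas leaves only the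
     change in the number of faces. *)
  have := genusP e; have := genusP (reembed e c).
  move: Eb Eg => /=; set ga := genus (reembed e c); set g0 := genus e.
  set i := #|incident_faces e nu|; lia.
rewrite inE; apply/andP/imsetP => [[/andP[/forallP bout sb] gb] | [p]].
  have bb : {in ~: nu, b =1 beta e}.
    by move=> x; rewrite inE => xA; apply/eqP/(implyP (bout x)).
  have bE := ext_restr bV sb bb; exists (restr_to sb) => //.
  by rewrite inE -(single_cycle_ext_perm bV) -key bE sb.
rewrite inE => /andP[sp np] ->; rewrite /is_reembedding single_cycle_ext_perm sp.
rewrite key ?single_cycle_ext_perm // np; split=> //; rewrite andbT.
by apply/forallP=> x; apply/implyP=> xA; rewrite ext_perm_out.
Qed.

(* The source prints the index as q + 2 * dg, which is refutable: with
   C(beta) - C(alpha) + C(gamma) = 2 - 2g, raising the genus by dg removes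
   2 * dg faces, so the index is q - 2 * dg. *)
Theorem theorem4p1 (m : nat) (e : cmap m) (nu : {set 'I_(2 * m)})
    (nuV : nu \in vertices (graph_of e))
    (q : nat) (hq : #|incident_faces e nu| = q) (dg : int) :
  R_count e nu dg
  = p_count (cycle_type (diagonal nuV)) (q%:Z - 2 * dg)%R (deg nu).
Proof.
have cn : #|{: {x | x \in nu}}| = deg nu by rewrite card_sig; apply: eq_card.
rewrite /p_count; case: pickP => [D0 /eqP ctD | noD].
  by rewrite (R_countE nuV) hq (pair_count_conj _ cn (esym ctD)).
(* The default branch of [p_count] cannot occur: an enumeration of [nu] transports the diagonal to a
   permutation of ['I_(deg nu)] with the same cycle type. *)
pose f x := cast_ord cn (enum_rank x).
pose g y : {x | x \in nu} := enum_val (cast_ord (esym cn) y).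
have fK : cancel f g by move=> x; rewrite /f /g cast_ordK enum_rankK.
have gK : cancel g f by move=> x; rewrite /f /g enum_valK cast_ordKV.
have f_bij : bijective f by exists g.
have /negP[] := noD (transport_perm fK gK (diagonal nuV)).
by rewrite (cycle_type_morph (transport_permE fK gK _) f_bij).
Qed.
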